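(* If $G$ is a finite, simple, connected, uniquely dimensional graph of order $n$, then $\beta(G)<\frac{n}{2}$.
   Context: For vertices $u,v$ of a connected graph $G$, $d(u,v)$ is the distance between them. For an ordered set $W=\{w_1,\dots,w_k\}\subseteq V(G)$ and $v\in V(G)$, $r(v|W)=(d(v,w_1),\dots,d(v,w_k))$. $W$ is a resolving set if distinct vertices have distinct representations $r(\cdot|W)$. A resolving set of minimum cardinality is a metric basis; its cardinality is the metric dimension $\beta(G)$. $G$ is uniquely dimensional if it has exactly one metric basis. *)

(* Defs.v *)
(* A finite simple graph is a symmetric irreflexive [e : rel T] on a
   [T : finType] of vertices. *)
From mathcomp Require Import all_boot all_order all_algebra.
Set Implicit Arguments.
Unset Strict Implicit.
Unset Printing Implicit Defensive.

(* The graph with no vertices is not considered connected. *)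
Definition connected_graph (T : finType) (e : rel T) : Prop :=
  0 < #|T| /\ forall x y : T, connect e x y.

Definition has_walk (T : finType) (e : rel T) (x y : T) (k : nat) : bool :=
  [exists p : k.-tuple T, path e x p && (last x p == y)].

(* Least length of a walk from x to y; a shortest walk has fewer than #|T|
   edges, and #|T| is the junk value when y is not reachable from x. *)
Definition dist (T : finType) (e : rel T) (x y : T) : nat :=
  find (has_walk e x y) (iota 0 #|T|).

(* r(v|W), with W ordered by the enumeration of T. *)
Definition representation (T : finType) (e : rel T) (W : {set T}) (v : T)
  : seq nat := [seq dist e v w | w <- enum W].

Definition resolving (T : finType) (e : rel T) (W : {set T}) : bool :=
  injectiveb (representation e W).

(* Every graph is resolved by its full vertex set, see [resolving_setT]. *)
Definition metric_dim (T : finType) (e : rel T) : nat :=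
  #|[arg min_(W < [set: T] | resolving e W) #|W|]|.

(* Bases are unordered: reordering W does not give another basis. *)
Definition metric_basis (T : finType) (e : rel T) (W : {set T}) : bool :=
  resolving e W && [forall W' : {set T}, resolving e W' ==> (#|W| <= #|W'|)].

Definition uniquely_dimensional (T : finType) (e : rel T) : Prop :=
  exists! W : {set T}, metric_basis e W.

Lemma has_walkP (T : finType) (e : rel T) (x y : T) (k : nat) :
  reflect (exists p : seq T, [/\ path e x p, last x p = y & size p = k])
          (has_walk e x y k).
Proof.
apply: (iffP existsP) => [[p /andP[ep /eqP lp]]|[p [ep lp sp]]].
  by exists p; rewrite size_tuple.
have sp' : size p == k by apply/eqP.
by exists (Tuple sp'); rewrite /= ep lp eqxx.
Qed.

Lemma dist_leq (T : finType) (e : rel T) (x : T) (p : seq T) :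
  path e x p -> dist e x (last x p) <= size p.
Proof.
move=> ep; rewrite /dist leqNgt; apply/negP => lt_pf.
have lt_pT : size p < #|T|.
  by apply: leq_trans lt_pf _; rewrite -{2}(size_iota 0 #|T|) find_size.
have := before_find 0 lt_pf; rewrite nth_iota // add0n => /has_walkP[].
by exists p.
Qed.

Lemma dist_walk (T : finType) (e : rel T) (x y : T) :
  connect e x y ->
  exists p : seq T, [/\ path e x p, last x p = y & size p = dist e x y].
Proof.
case/connectP => p0 ep0 ->; case/shortenP: ep0 => p ep up _.
have lt_pT : size p < #|T| by rewrite -[(size p).+1](card_uniqP up) max_card.
apply/has_walkP; rewrite /dist.
have hasf : has (has_walk e x (last x p)) (iota 0 #|T|).
  apply/hasP; exists (size p); first by rewrite mem_iota.
  by apply/has_walkP; exists p.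
have := nth_find 0 hasf; rewrite nth_iota ?add0n //.
by rewrite -{2}(size_iota 0 #|T|) -has_find.
Qed.

Lemma dist_eq0 (T : finType) (e : rel T) (x y : T) :
  (dist e x y == 0) = (x == y).
Proof.
apply/eqP/eqP => [|<-]; last first.
  by apply/eqP; rewrite -leqn0 (dist_leq (p := [::])).
have T0 : 0 < #|T| by apply/card_gt0P; exists x.
rewrite /dist; case: #|T| T0 => // n _ /=; case: ifP => // /has_walkP[p].
by case=> _ <- /size0nil ->.
Qed.

Lemma resolving_setT (T : finType) (e : rel T) : resolving e [set: T].
Proof.
apply/injectiveP => x y /eq_in_map /(_ y).
rewrite mem_enum inE => /(_ isT) exy.
by apply/eqP; rewrite -(dist_eq0 e) exy dist_eq0.
Qed.

Lemma metric_basisE (T : finType) (e : rel T) (W : {set T}) :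
  metric_basis e W = resolving e W && (#|W| == metric_dim e).
Proof.
rewrite /metric_basis /metric_dim; case: arg_minnP => [|B rB minB].
  exact: resolving_setT.
case rW: (resolving e W) => //=; rewrite eqn_leq (minB W rW) andbT.
apply/forallP/idP => [/(_ B)|leWB W']; first by rewrite rB.
by apply/implyP => /minB; apply: leq_trans.
Qed.

(* Main.v *)
Require Import Defs.
From mathcomp Require Import all_boot all_order all_algebra.

(** Let [W] be the only metric basis.  For [w] in [W], call a pair of distinct
    vertices [w]-private when no vertex of [W :\ w] resolves it.  A vertex of a
    pair resolves that pair, so private pairs avoid [W :\ w]; and as no exchange
    of [w] for another vertex yields a resolving set, no vertex other than [w]
    lies on all [w]-private pairs.  Being unresolved by [W :\ w] is transitive,
    so some [w]-private pair also avoids [w].  Hence, adding the elements of [W]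
    one at a time, each new [w] splits a class of vertices of [~: W] not yet
    distinguished, and [~: W] has more than [#|W|] elements. *)

(** Induction on [s] grows a set [S] in [U], one element larger than [s], whose elements are told
    apart by the indices in [s]; it starts from a singleton, hence [0 < #|U|]. *)
Lemma private_pairs_card (I D : eqType) (T : finType) (f : T -> I -> D)
    (U : {set T}) (s : seq I) :
  uniq s -> 0 < #|U| ->
  (forall i, i \in s -> exists x y, [/\ x \in U, y \in U, f x i != f y i &
     forall j, j \in s -> j != i -> f x j = f y j]) ->
  size s < #|U|.
Proof.
move=> us /card_gt0P[u uU] priv.
suff [S [/subset_leq_card leSU cS _]] : exists S : {set T},
    [/\ S \subset U, #|S| = (size s).+1 &
        {in S &, forall x y, {in s, f x =1 f y} -> x = y}] by rewrite -cS.
elim: s us priv => [_ _|i s IHs /= /andP[i_s us] priv].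
  exists [set u]; rewrite sub1set uU cards1; split=> // x y.
  by rewrite !inE => /eqP-> /eqP->.
have [j js|S [SU cS injS]] := IHs us.
  have [|x [y [xU yU fxy eqxy]]] := priv j; first by rewrite inE js orbT.
  by exists x, y; split=> // k ks; apply: eqxy; rewrite inE ks orbT.
have [|x [y [xU yU fxy eqxy]]] := priv i; first by rewrite mem_head.
have {}eqxy : {in s, f x =1 f y}.
  move=> j js; apply: eqxy; first by rewrite inE js orbT.
  by apply: contraNneq i_s => <-.
(* At most one [t] in [S] agrees on [s] with [x], hence with [y], and it cannot match both at [i].
   Take [y] if [t] matches [x], otherwise [x]. *)
have [z zU newz] : exists2 z, z \in U &
    {in S, forall t, ~ {in i :: s, f t =1 f z}}.
  have [/existsP[t /andP[tS /andP[/eqP ftx /allP eqtx]]]|/existsPn nox] :=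
    boolP [exists t, (t \in S) &&
                     all (fun j => f t j == f x j) (i :: s)]; last first.
    exists x => // t tS eqt; have /negP := nox t; apply.
    by rewrite tS; apply/allP => j js; rewrite eqt.
  exists y => // t' t'S eqt'.
  have tt' : t = t'.
    apply: injS => // j js.
    by rewrite (eqP (eqtx j js)) eqxy // eqt' // inE js orbT.
  by move/eqP: fxy; apply; rewrite -ftx tt' eqt' // mem_head.
exists (z |: S); split.
- by rewrite subUset sub1set zU.
- rewrite cardsU1 cS; case: (boolP (z \in S)) => // zS.
  by case: (newz z zS).
- move=> a b /setU1P[->|aS] /setU1P[->|bS] eqab //.
  + by case: (newz b bS) => j js; rewrite eqab.
  + by case: (newz a aS).
  + by apply: injS => // j js; apply: eqab; rewrite inE js orbT.
Qed.

Lemma resolvingP (T : finType) (e : rel T) (A : {set T}) :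
  reflect (forall x y, {in A, dist e x =1 dist e y} -> x = y) (resolving e A).
Proof.
apply: (iffP (injectiveP _)) => rA x y.
  by move=> eqxy; apply/rA/eq_in_map => w; rewrite mem_enum => /eqxy.
by move/eq_in_map => eqxy; apply: rA => w wA; apply: eqxy; rewrite mem_enum.
Qed.

(** A vertex of [A] is the only one at distance 0 from itself, so it is resolved from every other
    vertex. *)
Lemma unresolved_pair {T : finType} {e : rel T} {A : {set T}} :
  ~~ resolving e A ->
  exists x y, [/\ x != y, x \notin A, y \notin A &
                  {in A, dist e x =1 dist e y}].
Proof.
case/injectivePn => x [y xy /eq_in_map eqxy].
have {}eqxy : {in A, dist e x =1 dist e y}.
  by move=> w wA; apply: eqxy; rewrite mem_enum.
have d0 z : dist e z z = 0 by apply/eqP; rewrite dist_eq0.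
exists x, y; split=> //; apply: contra_neqN xy => zA; apply/eqP.
  by rewrite eq_sym -(dist_eq0 e) -eqxy // d0.
by rewrite -(dist_eq0 e) eqxy // d0.
Qed.

Lemma unique_basis_private_pair (T : finType) (e : rel T) (W : {set T}) (w : T) :
  metric_basis e W -> (forall W', metric_basis e W' -> W = W') -> w \in W ->
  exists x y, [/\ x \notin W, y \notin W, x != y &
                  {in W :\ w, dist e x =1 dist e y}].
Proof.
move=> bW uW wW.
have [rW /forallP minW] := andP bW.
have notWw z : z \notin W :\ w -> z != w -> z \notin W.
  by rewrite !inE => + zw; rewrite zw.
have cWw : #|W| = #|W :\ w|.+1 by rewrite (cardsD1 w W) wW.
have nrWw : ~~ resolving e (W :\ w).
  by apply/negP => /(implyP (minW _)); rewrite cWw ltnn.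
have [//|[y yW eqwy]] : (exists x y, [/\ x \notin W, y \notin W, x != y &
    {in W :\ w, dist e x =1 dist e y}]) \/
  exists2 y, y \notin W & {in W :\ w, dist e w =1 dist e y}.
  have [x [y [xy xW yW eqxy]]] := unresolved_pair nrWw.
  have [exw|xw] := eqVneq x w.
    right; exists y; first by rewrite notWw // -exw eq_sym.
    by move=> z zW; rewrite -{1}exw eqxy.
  have [eyw|yw] := eqVneq y w.
    by right; exists x; rewrite ?notWw // => z zW; rewrite -eyw eqxy.
  by left; exists x, y; rewrite !notWw.
(* This exchange keeps the cardinality, so if it resolved it would be a second basis. *)
have nrW' : ~~ resolving e (y |: W :\ w).
  apply/negP => rW'; case/negP: (yW).
  suff -> : W = y |: W :\ w by rewrite setU11.
  apply: uW; rewrite metric_basisE rW' cardsU1 in_setD1 (negPf yW) andbF.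
  by rewrite add1n -cWw; move: bW; rewrite metric_basisE => /andP[].
have [a [b [ab]]] := unresolved_pair nrW'.
rewrite !in_setU1 !negb_or => /andP[a_y aWw] /andP[b_y bWw] eqab.
have {}eqab : {in W :\ w, dist e a =1 dist e b}.
  by move=> z zW; apply: eqab; rewrite in_setU1 zW orbT.
(* If [w] is in the new pair, [y] can replace it by transitivity; the other member is not [y], since
   the pair avoids [y]. *)
have [eaw|aw] := eqVneq a w.
  exists b, y; split=> // [|z zW]; first by rewrite notWw // -eaw eq_sym.
  by rewrite -eqab // {1}eaw eqwy.
have [ebw|bw] := eqVneq b w.
  exists a, y; split=> // [|z zW]; first by rewrite notWw.
  by rewrite eqab // {1}ebw eqwy.
by exists a, b; rewrite !notWw.
Qed.

Theorem theorem3 (T : finType) (e : rel T) :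
  symmetric e -> irreflexive e -> connected_graph e ->
  uniquely_dimensional e ->
  ((metric_dim e)%:R < #|T|%:R / 2%:R :> rat)%R.
Proof.
move=> _ _ [T_gt0 _] [W [bW uW]].
have [/resolvingP rW /eqP <-] : resolving e W /\ #|W| == metric_dim e.
  by apply/andP; rewrite -metric_basisE.
rewrite Num.Theory.ltr_pdivlMr ?Num.Theory.ltr0n //.
rewrite -GRing.natrM Num.Theory.ltr_nat muln2 -addnn -(cardsC W) ltn_add2l.
(* The goal is now [#|W| < #|~: W|]. For nonempty [W], a private pair shows that [~: W] is
   nonempty. *)
have [->|[w0 w0W]] := set_0Vmem W; first by rewrite cards0 setC0 cardsT.
have priv := unique_basis_private_pair _ _ _ _ bW uW.
rewrite cardE; apply: (private_pairs_card _ _ _ (dist e)); first exact: enum_uniq.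
  have [x [y [xW _ _ _]]] := priv _ w0W.
  by apply/card_gt0P; exists x; rewrite inE.
move=> w; rewrite mem_enum => wW.
have [x [y [xW yW xy eqxy]]] := priv _ wW.
have {}eqxy v : v \in W -> v != w -> dist e x v = dist e y v.
  by move=> vW vw; apply: eqxy; rewrite !inE vw.
exists x, y; rewrite !inE; split=> // [|v]; last by rewrite mem_enum; apply: eqxy.
(* The pair must differ at [w], since [W] itself resolves it. *)
apply: contra_neq xy => dxy; apply: rW => v vW.
by have [->|] := eqVneq v w; last exact: eqxy.
Qed.
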